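(* Let $p$ be a prime. Then $K_0(\mathcal{B}(\mathbb{Q}_p(\mathbb{N}))) = 0$.
   Context: $\mathbb{Q}_p(\mathbb{N})$ is the set of maps $\xi:\mathbb{N}\to\mathbb{Q}_p$ with $|\xi(i)|_p\le 1$ for all but finitely many $i$; it is a $\mathbb{Z}_p$-module under coordinatewise operations. It carries the topology $\tau$ in which $A\subseteq\mathbb{Q}_p(\mathbb{N})$ is open iff for every finite $P\subseteq\mathbb{N}$ the set $A\cap\big(\prod_{i\in P}\mathbb{Q}_p\times\prod_{j\notin P}\mathbb{Z}_p\big)$ is open in the product topology. $\mathcal{B}(\mathbb{Q}_p(\mathbb{N}))$ is the ring of all $\tau$-continuous $\mathbb{Z}_p$-linear maps $\mathbb{Q}_p(\mathbb{N})\to\mathbb{Q}_p(\mathbb{N})$. $K_0$ is the algebraic $K_0$-group of a unital ring. *)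

(* Defs.v *)
From HB Require Import structures.
From mathcomp Require Import all_boot all_order all_algebra.
From mathcomp Require Import boolp.
Import Order.TTheory GRing.Theory Num.Theory.
Set Implicit Arguments. Unset Strict Implicit. Unset Printing Implicit Defensive.
Local Open Scope ring_scope.

(* An element xi of Q_p is represented by the sequence (x n)_n where   *)
(* x n is the unique element of Z[1/p] /\ [0, p^n) with                *)
(*   xi = x n  (mod p^n Z_p).                                          *)
(* An element a of Z_p is represented by its residues a n in [0, p^n). *)

Definition pw (p n : nat) : rat := ((p ^ n)%N)%:R.
Definition is_int (r : rat) : bool := r \is a Num.int.
Definition rmod (r m : rat) : rat := r - m * (Num.floor (r / m))%:~R.

Definition Zp_ok (p : nat) (a : nat -> int) : Prop :=
  forall n, 0 <= a n < ((p ^ n)%N)%:Z /\ (((p ^ n)%N)%:Z %| a n.+1 - a n)%Z.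

Definition Zp (p : nat) := {a : nat -> int | `[< Zp_ok p a >]}.

Definition Qp_ok (p : nat) (x : nat -> rat) : Prop :=
  [/\ forall n, 0 <= x n < pw p n,
      forall n, is_int ((x n.+1 - x n) / pw p n)
    & exists k, is_int (x 0%N * pw p k)].

Definition in_Zp (x : nat -> rat) : Prop := x 0%N = 0.

Definition QN_ok (p : nat) (xi : nat -> nat -> rat) : Prop :=
  (forall i, Qp_ok p (xi i)) /\ exists N : nat, forall i, (N <= i)%N -> in_Zp (xi i).

Definition QN (p : nat) := {xi : nat -> nat -> rat | `[< QN_ok p xi >]}.

Definition qp_add (p : nat) (x y : nat -> rat) : nat -> rat :=
  fun n => rmod (x n + y n) (pw p n).
(* x lies in p^(-k) Z_p for k = v_p(denominator of x 0) *)
Definition qp_den (x : nat -> rat) (p : nat) : nat := logn p `|denq (x 0%N)|%N.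
Definition qp_scale (p : nat) (a : nat -> int) (x : nat -> rat) : nat -> rat :=
  fun n => rmod ((a (n + qp_den x p)%N)%:~R * x (n + qp_den x p)%N) (pw p n).

(* Z_p-module operations on Q_p(N), coordinatewise.  [insubd] is only a
   typing device: the raw results always satisfy QN_ok, so the default
   (first) argument is never returned. *)
Definition QN_add (p : nat) (xi eta : QN p) : QN p :=
  insubd xi (fun i => qp_add p (val xi i) (val eta i)).
Definition QN_scale (p : nat) (a : Zp p) (xi : QN p) : QN p :=
  insubd xi (fun i => qp_scale p (val a) (val xi i)).
Definition QN_zero (p : nat) (xi : QN p) : QN p :=
  insubd xi (fun _ _ => 0).

(* For a finite P (a seq nat), S_P = prod_{i in P} Q_p x prod_{j notin P} Z_p *)
(* with the product topology; a basic neighbourhood of xi in S_P is    *)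
(*   { eta in S_P | eta i = xi i mod p^n Z_p for all i in F }          *)
(* for a finite F and n : nat.                                         *)
Definition in_SP (p : nat) (P : seq nat) (xi : QN p) : Prop :=
  forall j, j \notin P -> in_Zp (val xi j).

Definition open_in_SP (p : nat) (P : seq nat) (A : QN p -> Prop) : Prop :=
  forall xi, in_SP P xi -> A xi ->
    exists (F : seq nat) (n : nat), forall eta, in_SP P eta ->
      (forall i, i \in F -> val eta i n = val xi i n) -> A eta.

Definition tau_open (p : nat) (A : QN p -> Prop) : Prop :=
  forall P : seq nat, open_in_SP P A.

Definition tau_continuous (p : nat) (f : QN p -> QN p) : Prop :=
  forall A : QN p -> Prop, tau_open A -> tau_open (fun xi => A (f xi)).

Definition Zp_linear (p : nat) (f : QN p -> QN p) : Prop :=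
  (forall xi eta, f (QN_add xi eta) = QN_add (f xi) (f eta)) /\
  (forall a xi, f (QN_scale a xi) = QN_scale a (f xi)).

Definition inB (p : nat) (f : QN p -> QN p) : Prop :=
  Zp_linear f /\ tau_continuous f.

Definition B_add (p : nat) (f g : QN p -> QN p) : QN p -> QN p :=
  fun xi => QN_add (f xi) (g xi).
Definition B_mul (p : nat) (f g : QN p -> QN p) : QN p -> QN p := f \o g.
Definition B_zero (p : nat) : QN p -> QN p := fun xi => QN_zero xi.

(* Algebraic K_0 of a ring R (given by its carrier predicate S inside  *)
(* a type T and its operations), via idempotent matrices:               *)
(*  V(R) = idempotent square matrices over R modulo Murray-von Neumann  *)
(*  equivalence (e ~ f iff e = x y, f = y x), a monoid under block sum;  *)
(*  K_0(R) is its Grothendieck group, whose elements are classes of     *)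
(*  pairs (e, f) (standing for [e] - [f]) with                          *)
(*  (e, f) ~ (e', f') iff e (+) f' (+) g ~ e' (+) f (+) g for some g.     *)
Section K0.
Variables (T : Type) (S : T -> Prop) (add mul : T -> T -> T) (zero : T).

Definition mx (m n : nat) := 'I_m -> 'I_n -> T.
Definition mx_over m n (x : mx m n) : Prop := forall i j, S (x i j).
Definition mulM m k n (x : mx m k) (y : mx k n) : mx m n :=
  fun i j => \big[add/zero]_(l < k) mul (x i l) (y l j).
Definition idem n (e : mx n n) : Prop := mx_over e /\ mulM e e = e.
Definition diagM m n (e : mx m m) (f : mx n n) : mx (m + n) (m + n) :=
  fun i j => match split i, split j with
             | inl i', inl j' => e i' j'
             | inr i', inr j' => f i' j'
             | _, _ => zero end.
Definition mvn_eq m n (e : mx m m) (f : mx n n) : Prop :=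
  exists (x : mx m n) (y : mx n m), mx_over x /\ mx_over y /\
    mulM x y = e /\ mulM y x = f.

Record K0pair := K0Pair {
  k0_n : nat; k0_m : nat; k0_e : mx k0_n k0_n; k0_f : mx k0_m k0_m;
  k0_e_idem : idem k0_e; k0_f_idem : idem k0_f }.
Arguments k0_e : clear implicits.
Arguments k0_f : clear implicits.

Definition K0_eqv (u v : K0pair) : Prop :=
  exists (r : nat) (g : mx r r), idem g /\
    mvn_eq (diagM (diagM (k0_e u) (k0_f v)) g)
           (diagM (diagM (k0_e v) (k0_f u)) g).

Definition mx00 : mx 0 0 := fun i => match i with Ordinal _ H => False_rect _ (notF H) end.
Lemma mx00_idem : idem mx00.
Proof. split; [by move=> [] | by apply: funext => -[]]. Qed.

Definition K0_zero : K0pair := @K0Pair 0 0 mx00 mx00 mx00_idem mx00_idem.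

Definition K0_trivial : Prop := forall u : K0pair, K0_eqv u K0_zero.
End K0.

Definition K0_B_trivial (p : nat) : Prop :=
  K0_trivial (@inB p) (@B_add p) (@B_mul p) (@B_zero p).

(* Main.v *)
(* Write V = Q_p(N), L = Z_p^N and B for the ring of endomorphisms of V.  An
   Eilenberg swindle [e |-> e (+) e (+) ...] needs [e] to preserve L: an infinite
   direct sum of copies of [e] acts on the restricted product of copies of V only
   under this condition, which fails in general.  But L + e L is stable under an
   idempotent [e], and by continuity it is generated by L and finitely many
   vectors, so that some automorphism of V carries L onto it; hence [e] is
   conjugate to an idempotent preserving L.  Since V is isomorphic to V^n and to
   the restricted product of countably many copies of itself, the swindle shows
   that e (+) 1 is equivalent to 1 for every idempotent matrix [e] over B. *)
Require Import Defs.
From HB Require Import structures.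
From mathcomp Require Import all_boot all_order all_algebra.
From mathcomp Require Import boolp.
From mathcomp Require Import ring zify.
From Stdlib Require Cantor.
Set Implicit Arguments. Unset Strict Implicit. Unset Printing Implicit Defensive.
Import Order.TTheory GRing.Theory Num.Theory.
Local Open Scope ring_scope.

(** * Residues modulo powers of p *)

(** Two steps rest on small facts about lattices. Continuity gives a neighbourhood U of 0 inside L
    that [e] maps into L, and L is U plus the span of finitely many unit vectors; the images of
    these vectors generate L + e L over L. The automorphism is then assembled by adjoining vectors
    of order p modulo L one after the other. Since p^-1 Z_p / Z_p is cyclic of order p, all
    coordinates of such a vector are natural multiples, modulo Z_p, of a single non-integral
    coordinate, and a shear with division by p in that coordinate enlarges L by exactly this vector.
    Natural multiples suffice everywhere: N is dense in Z_p, so continuous additive maps are already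
    Z_p-linear, and generation can be phrased as closure under sums. In K_0 the stabilising summand
    is the unit 1, after which any two idempotents become equivalent. *)

Section Residues.
Variables (p : nat) (pp : prime p).

Let pw n : rat := Defs.pw p n.
(** The subgroup p^n Z of Q. As p^n Z_p meets Z[1/p] in p^n Z, congruences between p-adic numbers
    become memberships of rational representatives here. *)
Definition in_pw (n : nat) (r : rat) : bool := is_int (r / Defs.pw p n).

Lemma pw_gt0 n : 0 < pw n.
Proof. by rewrite /pw /Defs.pw ltr0n expn_gt0 prime_gt0. Qed.

Lemma pw_neq0 n : pw n != 0.
Proof. by rewrite gt_eqF // pw_gt0. Qed.

Lemma pwD m n : pw (m + n) = pw m * pw n.
Proof. by rewrite /pw /Defs.pw expnD natrM. Qed.

Lemma pw1 : pw 1 = p%:R. Proof. by rewrite /pw /Defs.pw expn1. Qed.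

Lemma in_pw_zmod_closed n : zmod_closed (in_pw n).
Proof.
split=> [|r s]; first by rewrite unfold_in mul0r; apply: rpred0.
by rewrite !unfold_in mulrBl; apply: rpredB.
Qed.
HB.instance Definition _ n :=
  GRing.isZmodClosed.Build _ (in_pw n) (in_pw_zmod_closed n).

Lemma in_pw_int n r : r \in in_pw n -> exists m : int, r = m%:~R * pw n.
Proof.
rewrite unfold_in /in_pw /is_int => /intrP [m rm]; exists m.
by rewrite -rm divfK // pw_neq0.
Qed.

Lemma int_in_pw n (m : int) : m%:~R * pw n \in in_pw n.
Proof. by rewrite unfold_in /in_pw /is_int mulfK ?pw_neq0 // intr_int. Qed.

Lemma in_pw_le m n r : (m <= n)%N -> r \in in_pw n -> r \in in_pw m.
Proof.
move=> /subnK <- /in_pw_int [k ->]; rewrite pwD mulrA.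
by rewrite -[pw (n - m)]/((p ^ (n - m))%N%:~R) -rmorphM int_in_pw.
Qed.

Lemma in_pwMint n (m : int) r : r \in in_pw n -> m%:~R * r \in in_pw n.
Proof. by move=> /in_pw_int [k ->]; rewrite mulrA -rmorphM int_in_pw. Qed.

Lemma in_pwMnat n (m : nat) r : r \in in_pw n -> m%:R * r \in in_pw n.
Proof. exact: (@in_pwMint n m). Qed.

Lemma in_pwM m n r s : r \in in_pw m -> s \in in_pw n -> r * s \in in_pw (m + n).
Proof.
move=> /in_pw_int [k ->] /in_pw_int [l ->].
by rewrite mulrACA -rmorphM -pwD int_in_pw.
Qed.

Lemma in_pwMpw k n r : (r * pw k \in in_pw (n + k)) = (r \in in_pw n).
Proof.
rewrite !unfold_in /in_pw -!/(pw _) pwD; congr is_int.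
by field; rewrite !pw_neq0.
Qed.

Lemma in_pwMpwW k n r : r \in in_pw n -> r * pw k \in in_pw n.
Proof. by rewrite -(in_pwMpw k n r) => /(in_pw_le (leq_addr k n)). Qed.

Lemma in_pw0E r : (r \in in_pw 0) = is_int r.
Proof. by rewrite unfold_in /in_pw divr1. Qed.

Lemma rmod_range n r : 0 <= rmod r (pw n) < pw n.
Proof.
have p0 := pw_gt0 n; rewrite /rmod.
have /andP[] := floor_itv (r / pw n).
rewrite rmorphD rmorph1 ler_pdivlMr // ltr_pdivrMr // mulrDl mul1r => h1 h2.
by rewrite subr_ge0 mulrC h1 ltrBlDr addrC.
Qed.

Lemma rmod_cong n r : rmod r (pw n) - r \in in_pw n.
Proof.
by rewrite /rmod addrAC subrr add0r mulrC -mulNr -rmorphN int_in_pw.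
Qed.

Lemma residue_uniq n r s :
  0 <= r < pw n -> 0 <= s < pw n -> r - s \in in_pw n -> r = s.
Proof.
move=> /andP[r0 rp] /andP[s0 sp] /in_pw_int [m rs]; have p0 := pw_gt0 n.
suff m0 : m = 0 by apply/eqP; rewrite -subr_eq0 rs m0 mul0r.
have h1 : m%:~R * pw n < 1 * pw n by rewrite -rs mul1r ltrBlDr (lt_le_trans rp) // lerDl.
have h2 : (-1) * pw n < m%:~R * pw n.
  by rewrite -rs mulN1r ltrBrDr addrC (lt_le_trans _ r0) // subr_lt0.
move: h1 h2; rewrite !ltr_pM2r // -[1]/(1%:~R) -rmorphN !ltr_int; lia.
Qed.

Lemma rmod_id n r : 0 <= r < pw n -> rmod r (pw n) = r.
Proof. by move=> r1; apply: residue_uniq (rmod_cong n r) => //; exact: rmod_range. Qed.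

(** [Qp_ok] without the normalisation to [0, p^n). Arithmetic is done termwise on such sequences,
    and [residues] normalises at the end. *)
Definition coherent (y : nat -> rat) : Prop :=
  (forall n, y n.+1 - y n \in in_pw n) /\ exists k, y 0%N * Defs.pw p k \in in_pw 0.

Definition residues (y : nat -> rat) : nat -> rat := fun n => rmod (y n) (Defs.pw p n).

Lemma residues_ok y : coherent y -> Qp_ok p (residues y).
Proof.
move=> [yS [k yk]]; split=> [n|n|]; first exact: rmod_range.
  rewrite -[is_int _]/(_ \in in_pw n) -/(pw n) -/(pw n.+1).
  have -> : residues y n.+1 - residues y n = (residues y n.+1 - y n.+1) +
     (y n.+1 - y n) - (residues y n - y n) by ring.
  apply: rpredB; last exact: rmod_cong.
  by apply: rpredD => //; apply: in_pw_le (leqnSn n) _; exact: rmod_cong.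
exists k; rewrite -in_pw0E.
have -> : residues y 0 * Defs.pw p k =
    (residues y 0 - y 0%N) * Defs.pw p k + y 0%N * Defs.pw p k by ring.
by apply: rpredD => //; apply/in_pwMpwW/rmod_cong.
Qed.

Lemma Qp_ok_coherent x : Qp_ok p x -> coherent x.
Proof. by case=> _ xS [k xk]; split=> //; exists k; rewrite in_pw0E. Qed.

Lemma coherentD x y : coherent x -> coherent y -> coherent (fun n => x n + y n).
Proof.
move=> [xS [k xk]] [yS [l yl]]; split=> [n|]; first by rewrite opprD addrACA rpredD.
exists (k + l)%N; rewrite -/(pw _) pwD mulrDl.
by apply: rpredD; [|rewrite [pw k * _]mulrC]; rewrite mulrA in_pwMpwW.
Qed.

Lemma coherentN x : coherent x -> coherent (fun n => - x n).
Proof.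
move=> [xS [k xk]]; split=> [n|]; first by rewrite -opprD rpredN.
by exists k; rewrite mulNr rpredN.
Qed.

Lemma coherent_cst (m : int) : coherent (fun => m%:~R).
Proof.
split=> [n|]; first by rewrite subrr rpred0.
by exists 0%N; rewrite -/(pw 0) int_in_pw.
Qed.

Lemma coherent_cong x m n : coherent x -> (m <= n)%N -> x n - x m \in in_pw m.
Proof.
move=> [xS _] /subnK <-; elim: (n - m)%N => [|k IH]; first by rewrite subrr rpred0.
rewrite addSn -[_ - _](subrKA (x (k + m)%N)); apply: rpredD => //.
exact: in_pw_le (leq_addl k m) (xS _).
Qed.

(** Dividing by p costs one digit of precision, hence the index [n.+1]. *)
Lemma coherent_div x : coherent x -> coherent (fun n => x n.+1 / p%:R).
Proof.
move=> cx; have [xS [k xk]] := cx; split=> [n|].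
  by rewrite -mulrBl -(in_pwMpw 1) -/(pw 1) pw1 divfK ?addn1 // -pw1 pw_neq0.
exists k.+1; rewrite -/(pw _) -(addn1 k) pwD pw1 mulrA mulrAC divfK; last first.
  by rewrite -pw1 pw_neq0.
have -> : x 1%N * pw k = (x 1%N - x 0%N) * pw k + x 0%N * pw k by ring.
by apply: rpredD => //; apply/in_pwMpwW/xS.
Qed.

(** The denominator of [x 0] divides a power of p, so it equals its own p-part p^d with d =
    [qp_den x p]; the other terms differ from [x 0] by integers. *)
Lemma qp_denP x : coherent x -> forall n, x n * Defs.pw p (qp_den x p) \in in_pw 0.
Proof.
move=> cx n; have [xS [k xk]] := cx; set d := qp_den x p.
have -> : x n * Defs.pw p d = (x n - x 0%N) * pw d + x 0%N * pw d by rewrite /pw; ring.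
apply: rpredD. exact/in_pwMpwW/coherent_cong.
have dk : (`|denq (x 0%N)| %| p ^ k)%N.
  move: xk; rewrite in_pw0E /is_int => /intrP [m xm].
  have : numq (x 0%N) * (p ^ k)%N%:Z = m * denq (x 0%N).
    apply: (@intr_inj rat); rewrite !rmorphM /= -xm -{2}(divq_num_den (x 0%N)).
    by rewrite /Defs.pw; field; rewrite intr_eq0 denq_neq0.
  move=> /(congr1 absz); rewrite !abszM => e.
  rewrite -(@Gauss_dvdr _ `|numq (x 0%N)|) ?e ?dvdn_mull //.
  by rewrite coprime_sym coprime_num_den.
have -> : pw d = (denq (x 0%N))%:~R.
  rewrite /pw /Defs.pw /d /qp_den -p_part -[in RHS](gez0_abs (ltW (denq_gt0 _))).
  rewrite part_pnat_id //; apply: pnat_dvd dk _.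
  by rewrite pnatX pnat_id.
by rewrite in_pw0E /is_int -{1}(divq_num_den (x 0%N)) divfK ?intr_eq0 ?denq_neq0 // intr_int.
Qed.

(** This justifies the shift by d = [qp_den x p] in [qp_scale]: changing [a] by a multiple of
    p^(n+d) changes the product only by a multiple of p^n, because p^d clears the denominators of
    x. *)
Lemma qp_scale_cong a x n M : Zp_ok p a -> coherent x ->
  (n + qp_den x p <= M)%N ->
  (a M)%:~R * x M - (a (n + qp_den x p)%N)%:~R * x (n + qp_den x p)%N \in in_pw n.
Proof.
move=> aok cx; set d := qp_den x p; set m := (n + d)%N => mM.
have aM : (a M - a m)%:~R \in in_pw m.
  rewrite -(subnK mM); elim: (M - m)%N => [|k IH]; first by rewrite subrr rpred0.
  rewrite addSn -[_ - _](subrKA (a (k + m)%N)) rmorphD rpredD //.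
  apply: in_pw_le (leq_addl k m) _; have [_] := aok (k + m)%N.
  by move=> /dvdzP [q ->]; rewrite rmorphM int_in_pw.
have -> : (a M)%:~R * x M - (a m)%:~R * x m =
  (a M - a m)%:~R * x M + (a m)%:~R * (x M - x m) by rewrite rmorphB /=; ring.
apply: rpredD; last first.
  by apply: in_pwMint; apply: in_pw_le (coherent_cong cx mM); rewrite leq_addr.
rewrite -(in_pwMpw d) -mulrA -[(n + d)%N]addn0 in_pwM //; exact: qp_denP.
Qed.

Lemma coherent_scale a x : Zp_ok p a -> coherent x ->
  coherent (fun n => (a (n + qp_den x p)%N)%:~R * x (n + qp_den x p)%N).
Proof.
move=> aok cx; split=> [n|].
  by apply: qp_scale_cong => //; rewrite leq_add2r.
by exists (qp_den x p); rewrite -mulrA in_pwMint // qp_denP.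
Qed.

End Residues.

(** * The additive group Q_p *)

(* The primality proof is a parameter of the type because [Qp_ok p] has no
   inhabitant at all when [p = 0]. *)
Definition Qp (p : nat) (pp : prime p) := {x : nat -> rat | `[< Qp_ok p x >]}.
HB.instance Definition _ (p : nat) (pp : prime p) := gen_eqMixin (Qp pp).
HB.instance Definition _ (p : nat) (pp : prime p) := gen_choiceMixin (Qp pp).

Section QpTheory.
Variables (p : nat) (pp : prime p).
Local Notation Qp := (Qp pp).
Implicit Types x y z : Qp.

Lemma Qp_ok_sval x : Qp_ok p (sval x).
Proof. by have /asboolP := svalP x. Qed.

Lemma coherent_sval x : coherent p (sval x).
Proof. exact/Qp_ok_coherent/Qp_ok_sval. Qed.

Definition mkQp w (cw : coherent p w) : Qp :=
  exist _ (residues p w) (asboolT (residues_ok pp cw)).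

Lemma mkQp_cong w (cw : coherent p w) n : sval (mkQp cw) n - w n \in in_pw p n.
Proof. exact: rmod_cong. Qed.

Lemma Qp_eqP x y : (forall n, sval x n - sval y n \in in_pw p n) -> x = y.
Proof.
move=> xy; have [[xr _ _] [yr _ _]] := (Qp_ok_sval x, Qp_ok_sval y).
have {xr yr xy} : sval x = sval y by apply: funext => n; exact: residue_uniq (xy n).
by case: x y => [x xok] [y yok] /= e; case: _ / e yok => yok; congr exist; exact: bool_irrelevance.
Qed.

Lemma in_pw_eq n r s : s = r -> r \in in_pw p n -> s \in in_pw p n.
Proof. by move=> ->. Qed.

Fact Qp_add_key : unit. Proof. exact: tt. Qed.
Fact Qp_opp_key : unit. Proof. exact: tt. Qed.

(* Unlocked, these operations would be compared by unification down to the
   rational residues. *)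
Definition Qp_add : Qp -> Qp -> Qp := locked_with Qp_add_key (fun x y =>
  mkQp (coherentD pp (coherent_sval x) (coherent_sval y))).
Definition Qp_opp : Qp -> Qp := locked_with Qp_opp_key (fun x =>
  mkQp (coherentN (coherent_sval x))).
Definition Qp_zero := mkQp (coherent_cst pp 0).
Definition Qp_one : Qp := mkQp (coherent_cst pp 1).

Lemma Qp_add_cong x y n : sval (Qp_add x y) n - (sval x n + sval y n) \in in_pw p n.
Proof. by rewrite [Qp_add]unlock; exact: mkQp_cong. Qed.

Lemma Qp_opp_cong x n : sval (Qp_opp x) n - - sval x n \in in_pw p n.
Proof. by rewrite [Qp_opp]unlock; exact: mkQp_cong. Qed.

Lemma Qp_zeroE n : sval Qp_zero n = 0.
Proof. by apply: (@rmod_id p pp n 0); rewrite lexx pw_gt0. Qed.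

Lemma Qp_addC : commutative Qp_add.
Proof.
move=> x y; apply: Qp_eqP => n.
have := rpredB (Qp_add_cong x y n) (Qp_add_cong y x n); apply: in_pw_eq; ring.
Qed.

Lemma Qp_addA : associative Qp_add.
Proof.
move=> x y z; apply: Qp_eqP => n.
have h1 := rpredD (Qp_add_cong x (Qp_add y z) n) (Qp_add_cong y z n).
have := rpredB h1 (rpredD (Qp_add_cong (Qp_add x y) z n) (Qp_add_cong x y n)).
apply: in_pw_eq; ring.
Qed.

Lemma Qp_add0 : left_id Qp_zero Qp_add.
Proof.
by move=> x; apply: Qp_eqP => n; have := Qp_add_cong Qp_zero x n; rewrite Qp_zeroE add0r.
Qed.

Lemma Qp_addN : left_inverse Qp_zero Qp_opp Qp_add.
Proof.
move=> x; apply: Qp_eqP => n; rewrite Qp_zeroE.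
have := rpredD (Qp_add_cong (Qp_opp x) x n) (Qp_opp_cong x n); apply: in_pw_eq; ring.
Qed.

HB.instance Definition _ := GRing.isZmodule.Build Qp Qp_addA Qp_addC Qp_add0 Qp_addN.

Lemma Qp_addE x y n : sval (x + y) n - (sval x n + sval y n) \in in_pw p n.
Proof. exact: Qp_add_cong. Qed.

Lemma sval_qp_add x y : sval (x + y) = qp_add p (sval x) (sval y).
Proof. by rewrite -[x + y]/(Qp_add x y) [Qp_add]unlock. Qed.

Lemma Qp_oppE x n : sval (- x) n + sval x n \in in_pw p n.
Proof. by rewrite -[X in _ + X]opprK; exact: Qp_opp_cong. Qed.

Lemma Qp_subE x y n : sval (x - y) n - (sval x n - sval y n) \in in_pw p n.
Proof.
have := rpredD (Qp_addE x (- y) n) (Qp_oppE y n); apply: in_pw_eq; ring.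
Qed.

Lemma Qp_mulnE x m n : sval (x *+ m) n - m%:R * sval x n \in in_pw p n.
Proof.
elim: m => [|m IH]; first by rewrite mulr0n Qp_zeroE mul0r subrr rpred0.
rewrite mulrSr; have := rpredD (Qp_addE (x *+ m) x n) IH; apply: in_pw_eq.
by rewrite -(natr1 m); ring.
Qed.

(** The subgroup p^n Z_p of Q_p. Residues being normalised, membership is the vanishing of a single
    rational number. *)
Definition pZ (n : nat) : {pred Qp} := [pred x | sval x n == 0].

Lemma pZE n x : (x \in pZ n) = (sval x n \in in_pw p n).
Proof.
rewrite inE; apply/eqP/idP => [->|h]; first exact: rpred0.
have [xr _ _] := Qp_ok_sval x; apply: (residue_uniq pp (xr n)); last by rewrite subr0.
by rewrite lexx pw_gt0.
Qed.

Lemma pZ_zmod_closed n : zmod_closed (pZ n).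
Proof.
split=> [|x y]; first by rewrite pZE Qp_zeroE rpred0.
by rewrite !pZE => hx hy; have := rpredD (Qp_subE x y n) (rpredB hx hy); rewrite subrK.
Qed.
HB.instance Definition _ n :=
  GRing.isZmodClosed.Build _ (pZ n) (pZ_zmod_closed n).

Lemma pZ_le m n x : (m <= n)%N -> x \in pZ n -> x \in pZ m.
Proof.
rewrite !pZE => mn hx; have := coherent_cong pp (coherent_sval x) mn.
rewrite -rpredN => /(rpredD (in_pw_le pp mn hx)); apply: in_pw_eq; ring.
Qed.

Lemma pZ_subE n x y : (x - y \in pZ n) = (sval x n == sval y n).
Proof.
have [[xr _ _] [yr _ _]] := (Qp_ok_sval x, Qp_ok_sval y).
rewrite pZE; apply/idP/eqP => [h|e]; last first.
  by have := Qp_subE x y n; rewrite e subrr subr0.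
apply: (residue_uniq pp (xr n) (yr n)).
have := rpredB h (Qp_subE x y n); apply: in_pw_eq; ring.
Qed.

Lemma pZ_separated x : (forall n, x \in pZ n) -> x = 0.
Proof. by move=> h; apply: Qp_eqP => n; rewrite Qp_zeroE subr0 -pZE. Qed.

Definition Qp_divp x : Qp := mkQp (coherent_div pp (coherent_sval x)).

Lemma Qp_divpE x n : sval (Qp_divp x) n - sval x n.+1 / p%:R \in in_pw p n.
Proof. exact: mkQp_cong. Qed.

Lemma Qp_divpK x : Qp_divp x *+ p = x.
Proof.
apply: Qp_eqP => n; have p0 : p%:R != 0 :> rat by rewrite pnatr_eq0 -lt0n prime_gt0.
have := rpredD (Qp_mulnE (Qp_divp x) p n)
  (rpredD (in_pwMnat pp p (Qp_divpE x n)) ((coherent_sval x).1 n)).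
apply: in_pw_eq; field => //.
Qed.

Lemma in_pw_divp r n : r \in in_pw p n.+1 -> r / p%:R \in in_pw p n.
Proof.
have p0 : p%:R != 0 :> rat by rewrite pnatr_eq0 -lt0n prime_gt0.
by rewrite -(in_pwMpw pp 1) pw1 divfK // addn1.
Qed.

Lemma Qp_mulpK x : Qp_divp (x *+ p) = x.
Proof.
apply: Qp_eqP => n; have p0 : p%:R != 0 :> rat by rewrite pnatr_eq0 -lt0n prime_gt0.
have := rpredD (Qp_divpE (x *+ p) n)
  (rpredD (in_pw_divp (Qp_mulnE x p n.+1)) ((coherent_sval x).1 n)).
apply: in_pw_eq; field => //.
Qed.

Lemma Qp_divpD x y : Qp_divp (x + y) = Qp_divp x + Qp_divp y.
Proof. by rewrite -[RHS]Qp_mulpK mulrnDl !Qp_divpK. Qed.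

Lemma pZ_divp n x : x \in pZ n.+1 -> Qp_divp x \in pZ n.
Proof.
rewrite !pZE => hx; have := rpredD (Qp_divpE x n) (in_pw_divp hx).
by rewrite subrK.
Qed.

(** Density of N in Z_p: the n-th residue of an integral x is itself a natural number, and it serves
    as m. *)
Lemma pZ_residue n x : x \in pZ 0 -> exists m : nat, x - Qp_one *+ m \in pZ n.
Proof.
rewrite pZE => x0; have [xr _ _] := Qp_ok_sval x.
have : sval x n \in in_pw p 0.
  by have := rpredD (coherent_cong pp (coherent_sval x) (leq0n n)) x0; rewrite subrK.
move=> /(in_pw_int pp) [m]; rewrite mulr1 => xm.
have [k mk] : exists k : nat, m = k.
  by have /andP[] := xr n; rewrite xm ler0z; case: m {xm} => // k _ _; exists k.
exists k; rewrite pZE.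
have := rpredB (rpredB (Qp_subE x (Qp_one *+ k) n) (Qp_mulnE Qp_one k n))
  (in_pwMnat pp k (mkQp_cong (coherent_cst pp 1) n)).
by apply: in_pw_eq; rewrite /Qp_one xm mk; ring.
Qed.

(* Both classes lie in [p^-1 Z_p / Z_p], which is cyclic of order [p]. *)
Lemma pZ_multiple x y : x *+ p \in pZ 0 -> x \notin pZ 0 -> y *+ p \in pZ 0 ->
  exists c : nat, y - x *+ c \in pZ 0.
Proof.
have num z : z *+ p \in pZ 0 -> exists a : int, p%:R * sval z 0%N = a%:~R.
  rewrite pZE => h; have := rpredB h (Qp_mulnE z p 0).
  by rewrite opprB addrC subrK => /(in_pw_int pp) [a]; rewrite mulr1; exists a.
move=> /num [a ax] x0 /num [b yb].
have p0 : p%:R != 0 :> rat by rewrite pnatr_eq0 -lt0n prime_gt0.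
have pa : ~~ (p%:Z %| a)%Z.
  apply: contra x0 => /dvdzP [q aq]; rewrite pZE in_pw0E /is_int.
  have -> : sval x 0%N = q%:~R; last exact: intr_int.
  by apply: (mulfI p0); rewrite ax aq rmorphM mulrC.
have [u [v uv]] : exists u v : int, u * p%:Z + v * a = 1.
  have := Bezoutz p%:Z a; case=> u [v e]; exists u, v; rewrite e.
  have : coprimez p%:Z a by rewrite coprimezE /= prime_coprime.
  by move=> /eqP.
(* The residues of x and y modulo Z_p are a/p and b/p, and v inverts a modulo p. Hence c = b/a
   modulo p, and p divides b - c a. *)
pose c := ((b * v) %% p%:Z)%Z.
have [k ck] : exists k : nat, c = k.
  have : 0 <= c by apply: modz_ge0; rewrite -lt0n prime_gt0.
  by case: c => // k _; exists k.
exists k; rewrite pZE.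
have := rpredB (Qp_subE y (x *+ k) 0) (Qp_mulnE x k 0).
suff h : sval y 0%N - k%:R * sval x 0%N \in in_pw p 0.
  by move=> /(fun t => rpredD t h); apply: in_pw_eq; ring.
(* The integer is (b - c a)/p, computed from b = b (u p + v a) and c = b v - p ((b v) %/ p). *)
rewrite in_pw0E /is_int; apply/intrP; exists (b * u + (b * v %/ p%:Z)%Z * a).
apply: (mulfI p0); rewrite mulrBr mulrCA ax yb.
have -> : k%:R = (b * v)%:~R - p%:R * ((b * v) %/ p%:Z)%Z%:~R :> rat.
  rewrite -[k%:R]/(k%:Z%:~R) -ck /c -[p%:R]/(p%:Z%:~R) -rmorphM -rmorphB; congr _%:~R.
  by rewrite {2}(divz_eq (b * v) p); ring.
have -> : b%:~R = b%:~R * (u * p%:Z + v * a)%:~R :> rat by rewrite uv mulr1.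
by rewrite !(rmorphD, rmorphM) /=; ring.
Qed.

Lemma Qp_bounded x : exists k, x *+ p ^ k \in pZ 0.
Proof.
have [_ [k xk]] := coherent_sval x; exists k; rewrite pZE.
by have := rpredD (Qp_mulnE x (p ^ k) 0) xk; rewrite [_ * Defs.pw p k]mulrC subrK.
Qed.

End QpTheory.
Arguments pZ {p} pp n _ : rename.

(** * The topological module Q_p(N) *)

Definition QpN (p : nat) (pp : prime p) := QN p.
HB.instance Definition _ (p : nat) (pp : prime p) := gen_eqMixin (QpN pp).
HB.instance Definition _ (p : nat) (pp : prime p) := gen_choiceMixin (QpN pp).

Section QpNTheory.
Variables (p : nat) (pp : prime p).
Local Notation V := (QpN pp).
Local Notation Qp := (Qp pp).
Implicit Types (xi eta : V) (F P : seq nat).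

Lemma QN_ok_sval xi : QN_ok p (sval xi).
Proof. by have /asboolP := svalP xi. Qed.

Definition coord xi (i : nat) : Qp := exist _ (sval xi i) (asboolT ((QN_ok_sval xi).1 i)).

Definition almost_integral (f : nat -> Qp) : Prop :=
  exists F, forall j, j \notin F -> f j \in pZ pp 0.

Lemma almost_integral_coord xi : almost_integral (coord xi).
Proof.
have [_ [N xN]] := QN_ok_sval xi; exists (iota 0 N) => j.
by rewrite mem_iota -leqNgt inE => Nj; apply/eqP/xN.
Qed.

Lemma almost_integral_ok (f : nat -> Qp) : almost_integral f -> QN_ok p (fun i => sval (f i)).
Proof.
move=> [F fF]; split=> [i|]; first exact: Qp_ok_sval.
exists (\max_(i <- F) i).+1 => i lti; apply/eqP; apply: (fF i).
apply: contraL lti => iF; rewrite -leqNgt.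
by rewrite (big_rem i) //= leq_maxl.
Qed.

Lemma coord_insubd xi (f : nat -> Qp) i : almost_integral f ->
  coord (insubd (xi : QN p) (fun i => sval (f i))) i = f i.
Proof.
move=> /almost_integral_ok ok; apply: Qp_eqP => n.
have e : sval (insubd (xi : QN p) (fun i => sval (f i))) = (fun i => sval (f i)).
  by rewrite -[sval _]/(val _) val_insubd asboolT.
have -> : sval (coord (insubd (xi : QN p) (fun i => sval (f i))) i) = sval (f i).
  exact: (congr1 (fun h => h i) e).
by rewrite subrr rpred0.
Qed.

Lemma coord_inj xi eta : coord xi =1 coord eta -> xi = eta.
Proof.
move=> h; have : sval xi = sval eta by apply: funext => i; exact: (congr1 sval (h i)).
exact: (@val_inj _ _ (QN p)).
Qed.

Lemma almost_integral0 : almost_integral (fun => 0).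
Proof. by exists [::] => j _; exact: rpred0. Qed.

Let QpN_default : V :=
  exist _ (fun i => sval (0 : Qp)) (asboolT (almost_integral_ok almost_integral0)).

(* Unlocked, these operations would be compared by unification down to [insubd]. *)
Fact mkQpN_key : unit. Proof. exact: tt. Qed.
Fact QpN_add_key : unit. Proof. exact: tt. Qed.

Definition mkQpN : (nat -> Qp) -> V := locked_with mkQpN_key (fun f =>
  insubd (QpN_default : QN p) (fun i => sval (f i))).

Lemma coord_mk f i : almost_integral f -> coord (mkQpN f) i = f i.
Proof. by rewrite [mkQpN]unlock; exact: coord_insubd. Qed.

Definition QpN_add : V -> V -> V := locked_with QpN_add_key (@QN_add p).

Lemma QpN_addE xi eta : QpN_add xi eta = QN_add xi eta.
Proof. by rewrite [QpN_add]unlock. Qed.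

Definition QpN_zero := mkQpN (fun => 0).

Definition QpN_opp xi : V := mkQpN (fun i => - coord xi i).

Lemma coord_QN_add xi eta i : coord (QN_add xi eta) i = coord xi i + coord eta i.
Proof.
have e : (fun i => qp_add p (val xi i) (val eta i)) =
    (fun i => sval (coord xi i + coord eta i)).
  by apply: funext => j; rewrite sval_qp_add.
rewrite /QN_add e; apply: coord_insubd.
have [F fF] := almost_integral_coord xi; have [G gG] := almost_integral_coord eta.
exists (F ++ G) => j; rewrite mem_cat negb_or => /andP[jF jG].
by rewrite rpredD ?fF ?gG.
Qed.

Lemma coord_opp xi i : coord (QpN_opp xi) i = - coord xi i.
Proof.
apply: coord_mk; have [F fF] := almost_integral_coord xi.
by exists F => j jF; rewrite rpredN fF.
Qed.

Lemma coord_zero i : coord QpN_zero i = 0.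
Proof. exact/coord_mk/almost_integral0. Qed.

Lemma coord_add xi eta i : coord (QpN_add xi eta) i = coord xi i + coord eta i.
Proof. by rewrite QpN_addE coord_QN_add. Qed.

Lemma QpN_addA : associative QpN_add.
Proof. by move=> x y z; apply: coord_inj => i; rewrite !coord_add addrA. Qed.

Lemma QpN_addC : commutative QpN_add.
Proof. by move=> x y; apply: coord_inj => i; rewrite !coord_add addrC. Qed.

Lemma QpN_add0 : left_id QpN_zero QpN_add.
Proof. by move=> x; apply: coord_inj => i; rewrite coord_add coord_zero add0r. Qed.

Lemma QpN_addN : left_inverse QpN_zero QpN_opp QpN_add.
Proof.
by move=> x; apply: coord_inj => i; rewrite coord_add coord_opp coord_zero addNr.
Qed.

HB.instance Definition _ := GRing.isZmodule.Build V QpN_addA QpN_addC QpN_add0 QpN_addN.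

Lemma coordD xi eta i : coord (xi + eta) i = coord xi i + coord eta i.
Proof. exact: coord_add. Qed.

Lemma coord_subE xi eta i : coord (xi - eta) i = coord xi i - coord eta i.
Proof. by rewrite -coord_opp -coord_add. Qed.

Lemma coord0 i : coord (0 : V) i = 0.
Proof. exact: coord_zero. Qed.

Lemma coordMn xi m i : coord (xi *+ m) i = coord xi i *+ m.
Proof. by elim: m => [|m IH]; rewrite ?mulr0n ?coord0 // !mulrS coordD IH. Qed.

Lemma QN_zeroE xi : QN_zero xi = 0 :> V.
Proof.
apply: coord_inj => i; rewrite coord0 -(coord_insubd xi i almost_integral0).
congr (coord (insubd _ _) _); apply: funext => j; apply: funext => n.
by rewrite Qp_zeroE.
Qed.

(** * The lattice Z_p^N and the neighbourhoods of 0 *)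

Definition integral : {pred V} := [pred xi | `[< forall j, coord xi j \in pZ pp 0 >]].

Lemma integralP xi : reflect (forall j, coord xi j \in pZ pp 0) (xi \in integral).
Proof. exact: asboolP. Qed.

Lemma integral_zmod_closed : zmod_closed integral.
Proof.
split=> [|xi eta /integralP xi0 /integralP eta0]; apply/integralP => j.
  by rewrite coord0 rpred0.
by rewrite coord_subE rpredB.
Qed.
HB.instance Definition _ := GRing.isZmodClosed.Build _ integral integral_zmod_closed.

(** These open subgroups form a base of neighbourhoods of 0 for tau. The lattice is itself open, so
    continuity at 0 can be tested inside it. *)
Definition ball F n xi : Prop :=
  xi \in integral /\ forall i, i \in F -> coord xi i \in pZ pp n.

Lemma ballB F n xi eta : ball F n xi -> ball F n eta -> ball F n (xi - eta).
Proof.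
move=> [h1 h2] [h3 h4]; split=> [|i iF]; first exact: rpredB.
by rewrite coord_subE rpredB ?h2 ?h4.
Qed.

Lemma ballD F n xi eta : ball F n xi -> ball F n eta -> ball F n (xi + eta).
Proof.
move=> [h1 h2] [h3 h4]; split=> [|i iF]; first exact: rpredD.
by rewrite coordD rpredD ?h2 ?h4.
Qed.

Lemma ball_sub F F' m n xi : {subset F <= F'} -> (m <= n)%N -> ball F' n xi -> ball F m xi.
Proof.
move=> FF mn [h1 h2]; split=> // i iF; apply: pZ_le mn _; exact/h2/FF.
Qed.

Lemma ball_separated xi : (forall F n, ball F n xi) -> xi = 0.
Proof.
move=> h; apply: coord_inj => i; rewrite coord0; apply: pZ_separated => n.
by have [_ ->] := h [:: i] n; rewrite ?inE.
Qed.

Lemma in_SPE P xi : in_SP P xi <-> forall j, j \notin P -> coord xi j \in pZ pp 0.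
Proof. by split=> h j /h hj; apply/eqP. Qed.

Lemma in_SP_exists xi : exists P, in_SP P xi.
Proof. by have [F fF] := almost_integral_coord xi; exists F; apply/in_SPE. Qed.

Lemma coord_val_eq xi eta i n : (val xi i n = val eta i n) <-> coord (xi - eta) i \in pZ pp n.
Proof. by rewrite coord_subE pZ_subE; split=> [/eqP|/eqP]. Qed.

(** Adding P to the tested coordinates turns a neighbourhood in S_P into a ball: on P, agreement
    modulo p^n makes the difference integral, and off P both vectors are integral. *)
Lemma ball_SP P F n xi eta : in_SP P xi -> in_SP P eta ->
  (forall i, i \in F ++ P -> val eta i n = val xi i n) -> ball F n (eta - xi).
Proof.
move=> /in_SPE xiP /in_SPE etaP h; split=> [|i iF]; last first.
  by apply/coord_val_eq/h; rewrite mem_cat iF.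
apply/integralP => j; have [jP|jP] := boolP (j \in P).
  by apply: (pZ_le (leq0n n)); apply/coord_val_eq/h; rewrite mem_cat jP orbT.
by rewrite coord_subE rpredB ?xiP ?etaP.
Qed.

Lemma ball_open F n : tau_open (ball F n).
Proof.
move=> P xi xiP xib; exists (F ++ P), n => eta etaP /(ball_SP xiP etaP).
by move=> /(ballD xib); rewrite addrC subrK.
Qed.

(** The working form of [inB]: additivity in place of Z_p-linearity, and continuity at 0 only, in
    terms of balls. [inB_cont_additive] and [cont_additive_inB] give the equivalence. *)
Definition cont_additive (f : V -> V) : Prop :=
  {morph f : xi eta / xi + eta} /\
  forall F n, exists F' n', forall xi, ball F' n' xi -> ball F n (f xi).

Lemma morphD0 (f : V -> V) : {morph f : xi eta / xi + eta} -> f 0 = 0.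
Proof. by move=> fD; apply: (addrI (f 0)); rewrite -fD !addr0. Qed.

Lemma morphDB (f : V -> V) : {morph f : xi eta / xi + eta} -> {morph f : xi eta / xi - eta}.
Proof. by move=> fD xi eta; apply: (addIr (f eta)); rewrite -fD !subrK. Qed.

Lemma morphDMn (f : V -> V) m : {morph f : xi eta / xi + eta} -> {morph f : xi / xi *+ m}.
Proof.
by move=> fD xi; elim: m => [|m IH]; rewrite ?mulr0n ?morphD0 // !mulrS fD IH.
Qed.

Lemma ball0 F n : ball F n 0.
Proof. by split=> [|i _]; rewrite ?coord0 rpred0. Qed.

Lemma inB_cont_additive f : inB f -> cont_additive f.
Proof.
move=> [[fD _] fcont].
have fD' : {morph (f : V -> V) : xi eta / xi + eta}.
  by move=> x y; rewrite -[x + y]/(QpN_add x y) QpN_addE fD -QpN_addE.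
split=> // F n.
(* For the empty P the set S_P is the lattice, where basic neighbourhoods of 0 are balls. *)
have [||F' [n' h]] := fcont _ (@ball_open F n) [::] (0 : V).
- by apply/in_SPE => j _; rewrite coord0 rpred0.
- by rewrite (morphD0 fD'); exact: ball0.
exists F', n' => xi [/integralP xi0 xiF]; apply: h => [|i iF].
  by apply/in_SPE.
by apply/coord_val_eq; rewrite subr0 xiF.
Qed.

(** * Scalars in Z_p as limits of natural numbers *)

Definition Qp_scale (a : Defs.Zp p) (x : Qp) : Qp :=
  mkQp pp (coherent_scale pp (asboolW (svalP a)) (coherent_sval x)).

(** The residues of [a] converge to [a]. The bound holds for all large M, so that several
    approximations can share one index. *)
Lemma Qp_scale_approx a (x : Qp) n : exists m : nat, forall M, (m <= M)%N ->
  Qp_scale a x - x *+ `|sval a M|%N \in pZ pp n.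
Proof.
exists (n + qp_den (sval x) p)%N => M mM; rewrite pZE.
have aok : Zp_ok p (sval a) by have /asboolP := svalP a.
have h1 := mkQp_cong pp (coherent_scale pp (asboolW (svalP a)) (coherent_sval x)) n.
have h2 := qp_scale_cong pp aok (coherent_sval x) mM.
have h3 := Qp_subE (Qp_scale a x) (x *+ `|sval a M|) n.
have h4 := Qp_mulnE x `|sval a M| n.
have nM : (n <= M)%N by apply: leq_trans mM; exact: leq_addr.
have h5 := in_pwMnat pp `|sval a M| (coherent_cong pp (coherent_sval x) nM).
have := rpredB (rpredB (rpredD h3 h1) h2) h4.
move=> /(fun h => rpredD h h5); apply: in_pw_eq.
have -> : (sval a M)%:~R = `|sval a M|%:R :> rat.
  by rewrite -[in LHS](gez0_abs (proj1 (andP (aok M).1))).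
by rewrite /Qp_scale; ring.
Qed.

Lemma almost_integral_scale a xi : almost_integral (fun i => Qp_scale a (coord xi i)).
Proof.
have [F fF] := almost_integral_coord xi; exists F => j jF.
have [m /(_ m (leqnn m)) h] := Qp_scale_approx a (coord xi j) 0.
by rewrite -[Qp_scale _ _](subrK (coord xi j *+ `|sval a m|)) rpredD ?rpredMn ?fF.
Qed.

Lemma coord_scale a xi i : coord (QN_scale a xi) i = Qp_scale a (coord xi i).
Proof. exact: (coord_insubd _ _ (almost_integral_scale a xi)). Qed.

(** Only finitely many coordinates constrain M: off P, where xi is integral, both terms of the
    difference are integral for every M. *)
Lemma QN_scale_approx a xi F n : exists m : nat, forall M, (m <= M)%N ->
  ball F n ((QN_scale a xi : V) - xi *+ `|sval a M|%N).
Proof.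
have [P xiP] := almost_integral_coord xi.
have [mu hmu] := choice (fun i => Qp_scale_approx a (coord xi i) n).
have mumax (i : nat) : i \in F ++ P -> (mu i <= \max_(i <- F ++ P) mu i)%N.
  by move=> iFP; rewrite (big_rem i) //= leq_maxl.
have coordE M i : coord ((QN_scale a xi : V) - xi *+ `|sval a M|%N) i =
    Qp_scale a (coord xi i) - coord xi i *+ `|sval a M|.
  by rewrite coord_subE coordMn coord_scale.
exists (\max_(i <- F ++ P) mu i) => M hM; split=> [|i iF]; last first.
  by rewrite coordE hmu // (leq_trans _ hM) // mumax // mem_cat iF.
apply/integralP => i; rewrite coordE; have [iP|iP] := boolP (i \in P).
  by apply: (pZ_le (leq0n n)); rewrite hmu // (leq_trans _ hM) // mumax // mem_cat iP orbT.
have [m /(_ m (leqnn m)) h] := Qp_scale_approx a (coord xi i) 0.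
rewrite -[Qp_scale _ _](subrK (coord xi i *+ `|sval a m|)) -addrA rpredD //.
by rewrite rpredB // rpredMn // xiP.
Qed.

(* [Z_p]-linearity comes for free: [Z] is dense in [Z_p] and [tau] is Hausdorff. *)
Lemma cont_additive_inB f : cont_additive f -> inB f.
Proof.
move=> [fD fcont]; split; last first.
  move=> A Aopen P xi xiP Afxi.
  (* Openness of A is used in a piece S_Q containing f xi. As f eta - f xi is integral for eta close
     to xi, f eta stays in S_Q. *)
  have [Q fxiQ] := in_SP_exists (f xi).
  have [F [n h]] := Aopen Q (f xi) fxiQ Afxi.
  have [F' [n' h']] := fcont F n.
  exists (F' ++ P), n' => eta etaP /(ball_SP xiP etaP) /h'.
  rewrite (morphDB fD) => -[/integralP b0 bF]; apply: h => [|i /bF]; last first.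
    by move/coord_val_eq.
  apply/in_SPE => j /((in_SPE _ _).1 fxiQ) fj.
  by have := b0 j; rewrite coord_subE => /rpredD /(_ fj); rewrite subrK.
split=> [x y|a xi]; first by rewrite -!QpN_addE; exact: fD.
apply: (@subr0_eq V); apply: ball_separated => F n.
have [F' [n' h']] := fcont F n.
have [m1 h1] := QN_scale_approx a xi F' n'.
have [m2 h2] := QN_scale_approx a (f xi) F n.
(* With x = a xi, y = a (f xi) and z = xi, subtracting the same natural multiple leaves f (a xi) - a
   (f xi) unchanged but makes both parts small. *)
have e (x y z : V) m : f (x - z *+ m) - (y - f z *+ m) = f x - y.
  by rewrite (morphDB fD) (morphDMn _ fD) opprB addrA subrK.
rewrite -(e (QN_scale a xi) (QN_scale a (f xi)) xi `|sval a (maxn m1 m2)|%N).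
apply: ballB; first by apply/h'/h1; exact: leq_maxl.
by apply: h2; exact: leq_maxr.
Qed.

End QpNTheory.

(** * The ring of endomorphisms *)

Definition BQp (p : nat) (pp : prime p) := {f : QN p -> QN p | `[< inB f >]}.
HB.instance Definition _ (p : nat) (pp : prime p) := gen_eqMixin (BQp pp).
HB.instance Definition _ (p : nat) (pp : prime p) := gen_choiceMixin (BQp pp).
Definition BQp_fun (p : nat) (pp : prime p) (f : BQp pp) : QpN pp -> QpN pp := sval f.
Coercion BQp_fun : BQp >-> Funclass.

Section BQpTheory.
Variables (p : nat) (pp : prime p).
Local Notation V := (QpN pp).
Local Notation Qp := (Qp pp).
Local Notation B := (BQp pp).
Local Notation L := (@integral p pp).
Implicit Types (xi eta : V) (F P : seq nat) (f g h : B).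

Lemma inB_sval f : inB (sval f).
Proof. by have /asboolP := svalP f. Qed.

Lemma BQp_cont f : cont_additive f.
Proof. exact/inB_cont_additive/inB_sval. Qed.

Definition mkB (f : V -> V) (cf : cont_additive f) : B :=
  exist _ f (asboolT (cont_additive_inB cf)).

Lemma BQp_eqP f g : f =1 g -> f = g.
Proof.
move=> /funext; case: f g => [f fB] [g gB]; rewrite /BQp_fun /= => e.
by case: _ / e gB => gB; congr exist; exact: bool_irrelevance.
Qed.

HB.instance Definition _ f := GRing.isZmodMorphism.Build V V f (morphDB (BQp_cont f).1).

Lemma cont_additiveD f g : cont_additive (fun xi => f xi + g xi).
Proof.
split=> [xi eta|F n]; first by rewrite !raddfD addrACA.
have [F1 [n1 h1]] := (BQp_cont f).2 F n; have [F2 [n2 h2]] := (BQp_cont g).2 F n.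
exists (F1 ++ F2), (maxn n1 n2) => xi b; apply: ballD; [apply: h1|apply: h2].
  by apply: ball_sub b; [move=> i iF; rewrite mem_cat iF|exact: leq_maxl].
by apply: ball_sub b; [move=> i iF; rewrite mem_cat iF orbT|exact: leq_maxr].
Qed.

Lemma cont_additiveN f : cont_additive (fun xi => - f xi).
Proof.
split=> [xi eta|F n]; first by rewrite !raddfD.
have [F1 [n1 h1]] := (BQp_cont f).2 F n; exists F1, n1 => xi /h1 b.
by rewrite -sub0r; apply: ballB => //; exact: ball0.
Qed.

Lemma cont_additive_comp f g : cont_additive (fun xi => f (g xi)).
Proof.
split=> [xi eta|F n]; first by rewrite !raddfD.
have [F1 [n1 h1]] := (BQp_cont f).2 F n; have [F2 [n2 h2]] := (BQp_cont g).2 F1 n1.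
by exists F2, n2 => xi /h2 /h1.
Qed.

Lemma cont_additive0 : cont_additive (fun _ : V => 0).
Proof. by split=> [xi eta|F n]; [rewrite addr0|exists [::], 0%N => xi _; exact: ball0]. Qed.

Lemma cont_additive_id : cont_additive (fun xi : V => xi).
Proof. by split=> // F n; exists F, n. Qed.

Definition BQp_add f g := mkB (cont_additiveD f g).
Definition BQp_opp f := mkB (cont_additiveN f).
Definition BQp_mul f g := mkB (cont_additive_comp f g).
Definition BQp_zero := mkB cont_additive0.
Definition BQp_one := mkB cont_additive_id.

Lemma BQp_addA : associative BQp_add.
Proof. by move=> f g h; apply: BQp_eqP => xi; exact: addrA. Qed.
Lemma BQp_addC : commutative BQp_add.
Proof. by move=> f g; apply: BQp_eqP => xi; exact: addrC. Qed.
Lemma BQp_add0 : left_id BQp_zero BQp_add.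
Proof. by move=> f; apply: BQp_eqP => xi; exact: add0r. Qed.
Lemma BQp_addN : left_inverse BQp_zero BQp_opp BQp_add.
Proof. by move=> f; apply: BQp_eqP => xi; exact: addNr. Qed.
HB.instance Definition _ := GRing.isZmodule.Build B BQp_addA BQp_addC BQp_add0 BQp_addN.

Lemma BQp_mulA : associative BQp_mul.
Proof. by move=> f g h; apply: BQp_eqP. Qed.
Lemma BQp_mul1 : left_id BQp_one BQp_mul.
Proof. by move=> f; apply: BQp_eqP. Qed.
Lemma BQp_mulr1 : right_id BQp_one BQp_mul.
Proof. by move=> f; apply: BQp_eqP. Qed.
Lemma BQp_mulDl : left_distributive BQp_mul +%R.
Proof. by move=> f g h; apply: BQp_eqP. Qed.
Lemma BQp_mulDr : right_distributive BQp_mul +%R.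
Proof. by move=> f g h; apply: BQp_eqP => xi; exact: (raddfD f). Qed.
HB.instance Definition _ := GRing.Zmodule_isPzRing.Build B
  BQp_mulA BQp_mul1 BQp_mulr1 BQp_mulDl BQp_mulDr.

Lemma BQp_funD f xi eta : f (xi + eta) = f xi + f eta. Proof. exact: (raddfD f). Qed.
Lemma BQp_fun0 f : f 0 = 0. Proof. exact: (raddf0 f). Qed.
Lemma BQpDE f g xi : (f + g : B) xi = f xi + g xi. Proof. by []. Qed.
Lemma BQpME f g xi : (f * g : B) xi = f (g xi). Proof. by []. Qed.
Lemma BQp1E xi : (1 : B) xi = xi. Proof. by []. Qed.
Lemma BQp0E xi : (0 : B) xi = 0. Proof. by []. Qed.

(** * Endomorphisms that move or discard coordinates *)

Section Reindex.
Variables (s : nat -> option nat) (t : nat -> nat).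
Hypothesis st : forall j i, s j = Some i -> j = t i.

(** By the hypothesis on t, the map s is injective where it is defined. Each input coordinate is
    copied at most once, so only finitely many output coordinates are non-integral. *)
Let reindex_coord xi j := if s j is Some i then coord xi i else 0.
Let reindex_fun xi : V := mkQpN (reindex_coord xi).

Lemma coord_reindex_fun xi j : coord (reindex_fun xi) j = reindex_coord xi j.
Proof.
apply: coord_mk; have [F fF] := almost_integral_coord xi.
exists [seq t i | i <- F] => {}j jF; rewrite /reindex_coord.
case sj: (s j) => [i|]; last exact: rpred0.
apply: fF; apply: contra jF => iF; rewrite (st sj); exact: map_f.
Qed.

Lemma reindex_cont : cont_additive reindex_fun.
Proof.
split=> [xi eta|F n].
  apply: coord_inj => j; rewrite coordD !coord_reindex_fun /reindex_coord.
  by case: (s j) => [i|]; rewrite ?addr0 ?coordD.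
exists (pmap s F), n => xi [/integralP b1 b2]; split=> [|j jF].
  apply/integralP => j; rewrite coord_reindex_fun /reindex_coord.
  by case: (s j) => [i|]; rewrite ?rpred0.
rewrite coord_reindex_fun /reindex_coord; case sj: (s j) => [i|]; rewrite ?rpred0 //.
by apply: b2; rewrite mem_pmap -sj map_f.
Qed.

Definition reindex : B := mkB reindex_cont.

Lemma coord_reindex xi j :
  coord (reindex xi) j = if s j is Some i then coord xi i else 0.
Proof. exact: coord_reindex_fun. Qed.

End Reindex.

(** * Shears and the straightening of lattices containing Z_p^N *)

Section Shear.
Variables (i : nat) (c : nat -> nat) (C : seq nat).
Hypothesis cC : forall j, j \notin C -> c j = 0%N.

(** Fixes the unit vectors e_j with j different from i and sends e_i to (e_i + sum of c_j e_j over j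
    different from i) / p. The image of the lattice therefore contains it with index p. *)
Let shear_coord xi j :=
  if j == i then Qp_divp (coord xi i) else coord xi j + Qp_divp (coord xi i) *+ c j.
Let shear_fun xi : V := mkQpN (shear_coord xi).
Let unshear_coord xi j :=
  if j == i then coord xi i *+ p else coord xi j - coord xi i *+ c j.
Let unshear_fun xi : V := mkQpN (unshear_coord xi).

Let coord_shear_fun xi j : coord (shear_fun xi) j = shear_coord xi j.
Proof.
apply: coord_mk; have [F fF] := almost_integral_coord xi.
exists (i :: C ++ F) => {}j; rewrite inE mem_cat !negb_or => /and3P[/negPf ji jC jF].
by rewrite /shear_coord ji cC // mulr0n addr0 fF.
Qed.

Let coord_unshear_fun xi j : coord (unshear_fun xi) j = unshear_coord xi j.
Proof.
apply: coord_mk; have [F fF] := almost_integral_coord xi.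
exists (i :: C ++ F) => {}j; rewrite inE mem_cat !negb_or => /and3P[/negPf ji jC jF].
by rewrite /unshear_coord ji cC // mulr0n subr0 fF.
Qed.

Lemma shear_cont : cont_additive shear_fun.
Proof.
split=> [xi eta|F n].
  apply: coord_inj => j; rewrite coordD !coord_shear_fun /shear_coord.
  by case: eqP => _; rewrite !coordD Qp_divpD // mulrnDl addrACA.
exists (i :: F), n.+1 => xi [/integralP b1 b2].
have di : Qp_divp (coord xi i) \in pZ pp n by apply/pZ_divp/b2; rewrite mem_head.
split=> [|j jF].
  apply/integralP => j; rewrite coord_shear_fun /shear_coord.
  have di0 := pZ_le (leq0n n) di.
  by case: eqP => _ //; rewrite rpredD ?rpredMn.
rewrite coord_shear_fun /shear_coord; case: eqP => _ //; rewrite rpredD ?rpredMn //.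
by apply: (pZ_le (leqnSn n)); apply: b2; rewrite inE jF orbT.
Qed.

Lemma unshear_cont : cont_additive unshear_fun.
Proof.
split=> [xi eta|F n].
  apply: coord_inj => j; rewrite coordD !coord_unshear_fun /unshear_coord.
  by case: eqP => _; rewrite !coordD mulrnDl // opprD addrACA.
exists (i :: F), n => xi [/integralP b1 b2].
split=> [|j jF].
  apply/integralP => j; rewrite coord_unshear_fun /unshear_coord.
  by case: eqP => _ //; rewrite ?rpredB ?rpredMn.
have bi : coord xi i \in pZ pp n by apply: b2; rewrite mem_head.
rewrite coord_unshear_fun /unshear_coord; case: eqP => _; rewrite ?rpredB ?rpredMn //.
by apply: b2; rewrite inE jF orbT.
Qed.

Definition shear : B := mkB shear_cont.
Definition unshear : B := mkB unshear_cont.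

Lemma coord_shear xi j : coord (shear xi) j =
  if j == i then Qp_divp (coord xi i) else coord xi j + Qp_divp (coord xi i) *+ c j.
Proof. exact: coord_shear_fun. Qed.

Lemma coord_unshear xi j : coord (unshear xi) j =
  if j == i then coord xi i *+ p else coord xi j - coord xi i *+ c j.
Proof. exact: coord_unshear_fun. Qed.

Lemma shearK : unshear * shear = 1.
Proof.
apply: BQp_eqP => xi; apply: coord_inj => j.
rewrite BQpME coord_unshear !coord_shear eqxx.
by case: eqP => [->|_]; [rewrite Qp_divpK|rewrite addrK].
Qed.

Lemma unshearK : shear * unshear = 1.
Proof.
apply: BQp_eqP => xi; apply: coord_inj => j.
rewrite BQpME coord_shear !coord_unshear eqxx.
by case: eqP => [->|_]; rewrite Qp_mulpK // subrK.
Qed.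

Lemma unshear_integral xi : xi \in L -> unshear xi \in L.
Proof.
move=> /integralP h; apply/integralP => j; rewrite coord_unshear.
by case: eqP => _; rewrite ?rpredB ?rpredMn.
Qed.

End Shear.

(* [g L] is the submodule generated by [L] and [ws]. *)
Definition straightens g h (ws : seq V) : Prop :=
  [/\ g * h = 1, h * g = 1, {in L, forall xi, h xi \in L}, {in ws, forall w, h w \in L}
    & forall H : V -> Prop, (forall xi eta, H xi -> H eta -> H (xi + eta)) ->
        {in L, forall xi, H xi} -> {in ws, forall w, H w} -> {in L, forall xi, H (g xi)}].

(** Since g2 L is generated by L and the vectors h u, its image under g is generated by g L and us,
    that is by L, ws and us. *)
Lemma straightens_comp g h g2 h2 ws us :
  straightens g h ws -> straightens g2 h2 [seq h u | u <- us] ->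
  straightens (g * g2 : B) (h2 * h : B) (ws ++ us).
Proof.
move=> [gh hg hL hws Hg] [gh2 hg2 hL2 hws2 Hg2]; split.
- by rewrite mulrA -[g * g2 * h2]mulrA gh2 mulr1.
- by rewrite mulrA -[h2 * h * g]mulrA hg mulr1.
- by move=> xi /hL /hL2.
- move=> w; rewrite mem_cat => /orP[/hws /hL2 //|wu]; rewrite BQpME.
  by apply: hws2; exact: map_f.
- move=> H HD HL Hw; apply: (Hg2 (H \o g)) => [xi eta h3 h4|xi xiL|_ /mapP[u uu ->]].
  + by rewrite /= raddfD; exact: HD.
  + by apply: Hg xiL => // w ww; apply: Hw; rewrite mem_cat ww.
  + by rewrite /= -BQpME gh; apply: Hw; rewrite mem_cat uu orbT.
Qed.

(** Serves to discard auxiliary vectors that are already generated by L and us, such as multiples of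
    a vector in us. *)
Lemma straightens_sub g h ws us : {subset us <= ws} ->
  (forall H : V -> Prop, (forall xi eta, H xi -> H eta -> H (xi + eta)) ->
    {in L, forall xi, H xi} -> {in us, forall w, H w} -> {in ws, forall w, H w}) ->
  straightens g h ws -> straightens g h us.
Proof.
move=> sub gen [gh hg hL hws Hg]; split=> // [w /sub /hws //|H HD HL Hw].
by apply: Hg => //; exact: gen.
Qed.

(** If w is not in L, some coordinate w_i is non-integral and generates p^-1 Z_p / Z_p. Then w_j =
    c_j w_i modulo Z_p for all j, and the shear with these c_j maps L onto the lattice generated by
    L and w. *)
Lemma straightens_step w : w *+ p \in L -> exists g h, straightens g h [:: w].
Proof.
move=> /integralP pw; have {}pw j : coord w j *+ p \in pZ pp 0 by rewrite -coordMn.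
have [wL|wL] := boolP (w \in L).
  exists 1, 1; split=> [|||u|H _ HL _ xi /HL //]; rewrite ?mulr1 //.
  by rewrite inE => /eqP ->.
have [i wi] : exists i, coord w i \notin pZ pp 0.
  apply: contrapT => h; move/negP: wL; apply; apply/integralP => j.
  by apply: contrapT => /negP hj; apply: h; exists j.
have [P wP] := almost_integral_coord w.
(* Off P the coordinate of w is integral and c_j = 0 is imposed, so that c has finite support. *)
have /choice [c cw] : forall j, exists c : nat,
    coord w j - coord w i *+ c \in pZ pp 0 /\ (j \notin P -> c = 0%N).
  move=> j; have [jP|jP] := boolP (j \in P).
    by have [c hc] := pZ_multiple (pw i) wi (pw j); exists c.
  by exists 0%N; rewrite mulr0n subr0 wP.
have cP j : j \notin P -> c j = 0%N by have [_] := cw j.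
exists (shear i cP), (unshear i cP); split.
- exact: unshearK.
- exact: shearK.
- exact: unshear_integral.
- move=> u; rewrite inE => /eqP ->; apply/integralP => j; rewrite coord_unshear.
  by case: eqP => _ //; have [] := cw j.
- move=> H HD HL Hw xi xiL; have /integralP xi0 := xiL.
  (* Here t solves xi_i / p = t w_i modulo Z_p; the sheared vector minus t w is then integral in
     every coordinate. *)
  have [t ht] : exists t : nat, Qp_divp (coord xi i) - coord w i *+ t \in pZ pp 0.
    by apply: (pZ_multiple (pw i) wi); rewrite Qp_divpK.
  have Ht m : H (w *+ m).
    elim: m => [|m IH]; first by rewrite mulr0n; apply: HL; exact: rpred0.
    by rewrite mulrS; apply: HD => //; apply: Hw; rewrite inE.
  rewrite -[shear _ _ _](subrK (w *+ t)); apply: HD => //; apply: HL.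
  apply/integralP => j; rewrite coord_subE coordMn coord_shear.
  case: eqP => [->|_] //; have [cj _] := cw j.
  have -> : coord xi j + Qp_divp (coord xi i) *+ c j - coord w j *+ t =
     coord xi j + (Qp_divp (coord xi i) - coord w i *+ t) *+ c j
       - (coord w j - coord w i *+ c j) *+ t.
    rewrite !mulrnBl -!mulrnA [(c j * t)%N]mulnC opprB !addrA; congr (_ - _).
    by rewrite subrK.
  by rewrite rpredB ?rpredD ?rpredMn.
Qed.

Lemma bounded xi : exists k, xi *+ p ^ k \in L.
Proof.
have [P xiP] := almost_integral_coord xi.
have [k hk] := choice (fun j => Qp_bounded (coord xi j)).
exists (\max_(j <- P) k j); apply/integralP => j; rewrite coordMn.
have [jP|/xiP jP] := boolP (j \in P); last exact: rpredMn.
have /subnKC <- : (k j <= \max_(j <- P) k j)%N by rewrite (big_rem j) //= leq_maxl.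
by rewrite expnD mulrnA rpredMn.
Qed.

(** If p^(k+1) u lies in L, the vector p^k u has order at most p modulo L and is treated by one
    shear at most. Afterwards p^k multiplies the transported vector into L, and the induction
    continues. *)
Lemma straightens_one k u : u *+ p ^ k \in L -> exists g h, straightens g h [:: u].
Proof.
elim: k u => [|k IH] u uk.
  by apply: straightens_step; apply: rpredMn; rewrite expn0 in uk.
have [|g1 [h1 s1]] := @straightens_step (u *+ p ^ k).
  by rewrite -mulrnA mulnC -expnS.
have [|g2 [h2 s2]] := IH (h1 u).
  by have [_ _ _ hu _] := s1; rewrite -raddfMn; apply: hu; rewrite inE.
exists (g1 * g2), (h2 * h1); apply: straightens_sub (straightens_comp s1 (us := [:: u]) s2).
  by move=> v; rewrite !inE => ->; rewrite orbT.
move=> H HD HL Hu v; rewrite !inE => /orP[/eqP ->|/eqP ->]; last exact/Hu/mem_head.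
elim: (p ^ k)%N => [|m Hm]; first by rewrite mulr0n; apply: HL; exact: rpred0.
by rewrite mulrS; apply: HD => //; exact/Hu/mem_head.
Qed.

Lemma straightens_seq ws : exists g h, straightens g h ws.
Proof.
elim: ws => [|w ws [g1 [h1 s1]]].
  by exists 1, 1; split=> [|||//|H _ HL _ xi /HL //]; rewrite ?mulr1.
have [k hk] := bounded (h1 w); have [g2 [h2 s2]] := straightens_one hk.
exists (g1 * g2), (h2 * h1); apply: straightens_sub (straightens_comp s1 (us := [:: w]) s2).
  by move=> v; rewrite mem_cat !inE orbC.
by move=> H _ _ Hw v; rewrite mem_cat mem_seq1 orbC => vw; apply: Hw; rewrite inE.
Qed.

(** * Conjugating an idempotent to one that preserves Z_p^N *)

Lemma almost_integral_delta i : almost_integral (fun j => if j == i then Qp_one pp else 0).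
Proof. by exists [:: i] => j; rewrite inE => /negPf ->; exact: rpred0. Qed.

Definition delta i : V := mkQpN (fun j => if j == i then Qp_one pp else 0).

Lemma coord_delta i j : coord (delta i) j = if j == i then Qp_one pp else 0.
Proof. exact/coord_mk/almost_integral_delta. Qed.

Lemma Qp_one_integral : Qp_one pp \in pZ pp 0.
Proof.
rewrite pZE; have := mkQp_cong pp (coherent_cst pp 1) 0.
by move=> h; have := rpredD h (int_in_pw pp 0 1); rewrite mulr1 subrK.
Qed.

(** The coordinates in F are approximated modulo p^n by natural numbers, and the others are
    unconstrained in the ball. [undup] prevents a repeated index from being counted twice. *)
Lemma integral_mod_ball F n xi : xi \in L ->
  exists m : nat -> nat, ball F n (xi - \sum_(i <- undup F) delta i *+ m i).
Proof.
move=> /integralP xi0.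
have [m hm] := choice (fun i => pZ_residue n (xi0 i)); exists m.
have coordS j : coord (\sum_(i <- undup F) delta i *+ m i) j =
    if j \in F then Qp_one pp *+ m j else 0.
  rewrite (big_morph _ (fun xi eta => coordD xi eta j) (coord0 pp j)).
  under eq_bigr => i _ do rewrite coordMn coord_delta.
  have [jF|jF] := boolP (j \in F).
    rewrite (bigD1_seq j) ?mem_undup ?undup_uniq //= eqxx big1 ?addr0 // => i /negPf.
    by rewrite eq_sym => ->; rewrite mul0rn.
  rewrite big_seq big1 // => i; rewrite mem_undup => iF.
  case: eqP => [ji|_]; last by rewrite mul0rn.
  by rewrite ji iF in jF.
split=> [|j jF]; last by rewrite coord_subE coordS jF hm.
apply/integralP => j; rewrite coord_subE coordS rpredB //.
by case: ifP => _; rewrite ?rpred0 // rpredMn // Qp_one_integral.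
Qed.

(* The lattice [L + f L] is stable under the idempotent [f], and it is
   generated by [L] and finitely many vectors because [f] is continuous. *)
Lemma idempotent_conj_integral f : f * f = f ->
  exists g h, [/\ g * h = 1, h * g = 1 & {in L, forall xi, h (f (g xi)) \in L}].
Proof.
(* As [ball [::] 0] is L, this yields a ball that f maps into L. *)
move=> ff; have [F [n fF]] := (BQp_cont f).2 [::] 0%N.
have [g [h [gh hg hL hws Hg]]] := straightens_seq [seq f (delta i) | i <- F].
exists g, h; split=> //; apply: (Hg (fun xi => h (f xi) \in L)).
- by move=> xi eta h1 h2; rewrite !raddfD rpredD.
- move=> xi /(integral_mod_ball F n) [m /fF [fb _]].
  have := hL _ fb; rewrite !raddfB /= => fb'.
  rewrite -[h (f xi)](subrK (h (f (\sum_(i <- undup F) delta i *+ m i)))).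
  apply: rpredD => //; rewrite !raddf_sum big_seq; apply: rpred_sum => i.
  rewrite mem_undup => iF; rewrite 2!raddfMn rpredMn //.
  exact/hws/map_f.
(* Idempotence enters here: f fixes the added generators f (delta i), which h sends into L. *)
- by move=> _ /mapP[i iF ->]; rewrite -(BQpME f f) ff; exact/hws/map_f.
Qed.

End BQpTheory.

(** * Rows and the swindle *)

Section Rows.
Variables (p : nat) (pp : prime p).
Local Notation V := (QpN pp).
Local Notation B := (BQp pp).
Local Notation L := (@integral p pp).
Implicit Types (xi eta : V) (e : B).

(* [V] is viewed as a space of sequences of rows, through a bijection of N x N with N. *)
Definition code (a b : nat) : nat := Cantor.to_nat (a, b).
Definition row_of (n : nat) : nat := (Cantor.of_nat n).1.
Definition col_of (n : nat) : nat := (Cantor.of_nat n).2.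

Lemma row_of_code a b : row_of (code a b) = a.
Proof. by rewrite /row_of /code Cantor.cancel_of_to. Qed.

Lemma col_of_code a b : col_of (code a b) = b.
Proof. by rewrite /col_of /code Cantor.cancel_of_to. Qed.

Lemma code_row_col n : code (row_of n) (col_of n) = n.
Proof. by rewrite /code -surjective_pairing Cantor.cancel_to_of. Qed.

Lemma take_row_inj k j i : Some (code k j) = Some i -> j = col_of i.
Proof. by case=> <-; rewrite col_of_code. Qed.
Definition take_row k : B := reindex pp (@take_row_inj k).

Lemma put_row_inj k j i :
  (if row_of j == k then Some (col_of j) else None) = Some i -> j = code k i.
Proof. by case: eqP => // <- [<-]; rewrite code_row_col. Qed.
Definition put_row k : B := reindex pp (@put_row_inj k).

Lemma push_rows_inj j i :
  (if row_of j is a.+1 then Some (code a (col_of j)) else None) = Some i ->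
  j = code (row_of i).+1 (col_of i).
Proof.
by case aj: (row_of j) => [//|a] [<-]; rewrite row_of_code col_of_code -aj code_row_col.
Qed.
Definition push_rows : B := reindex pp (@push_rows_inj).

Lemma pull_rows_inj j i :
  Some (code (row_of j).+1 (col_of j)) = Some i -> j = code (row_of i).-1 (col_of i).
Proof. by case=> <-; rewrite row_of_code col_of_code code_row_col. Qed.
Definition pull_rows : B := reindex pp (@pull_rows_inj).

Lemma coord_take_row k xi j : coord (take_row k xi) j = coord xi (code k j).
Proof. exact: coord_reindex. Qed.

Lemma rows_inj xi eta : (forall k, take_row k xi = take_row k eta) -> xi = eta.
Proof.
move=> h; apply: coord_inj => n; rewrite -(code_row_col n).
by rewrite -!coord_take_row h.
Qed.

Lemma take_put_row k l xi : take_row k (put_row l xi) = if k == l then xi else 0.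
Proof.
apply: coord_inj => j; rewrite coord_take_row coord_reindex row_of_code col_of_code.
by case: eqP => _; rewrite ?coord0.
Qed.

Lemma take_push_rows k xi : take_row k (push_rows xi) = if k is a.+1 then take_row a xi else 0.
Proof.
apply: coord_inj => j; rewrite coord_take_row coord_reindex row_of_code col_of_code.
by case: k => [|k]; rewrite ?coord0 // coord_take_row.
Qed.

Lemma take_pull_rows k xi : take_row k (pull_rows xi) = take_row k.+1 xi.
Proof.
by apply: coord_inj => j; rewrite !coord_take_row coord_reindex row_of_code col_of_code.
Qed.

Lemma take_row_integral k xi : xi \in L -> take_row k xi \in L.
Proof. by move=> /integralP h; apply/integralP => j; rewrite coord_take_row. Qed.

(** * The infinite direct sum of copies of an endomorphism preserving Z_p^N *)

Section RowWise.
Variable e : B.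
Hypothesis e_integral : {in L, forall xi, e xi \in L}.

Let rowwise_coord xi n := coord (e (take_row (row_of n) xi)) (col_of n).
Let rowwise_fun xi : V := mkQpN (rowwise_coord xi).

(** All but finitely many rows of xi are integral, and e keeps them so. Each of the remaining rows
    has an image with finitely many non-integral coordinates. *)
Let coord_rowwise_fun xi n : coord (rowwise_fun xi) n = rowwise_coord xi n.
Proof.
apply: coord_mk; have [F fF] := almost_integral_coord xi.
have /choice [G hG] : forall a, exists P : seq nat, forall j, j \notin P ->
    coord (e (take_row a xi)) j \in pZ pp 0.
  by move=> a; exact: almost_integral_coord.
exists [seq code a b | a <- [seq row_of i | i <- F], b <- G a] => {}n nF.
rewrite /rowwise_coord; have [rF|rF] := boolP (row_of n \in [seq row_of i | i <- F]).
  apply: hG; apply: contra nF => cG; rewrite -[n]code_row_col.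
  by apply/allpairsPdep; exists (row_of n), (col_of n).
apply: (integralP _ _); apply: e_integral; apply/integralP => j.
rewrite coord_take_row; apply: fF; apply: contra rF => jF; apply/mapP.
by exists (code (row_of n) j); rewrite ?row_of_code.
Qed.

(** A single ball for e, taken over all columns that occur in F, controls each of the finitely many
    rows meeting F; in the other rows integrality is enough. *)
Lemma rowwise_cont : cont_additive rowwise_fun.
Proof.
split=> [xi eta|F n].
  by apply: coord_inj => j; rewrite coordD !coord_rowwise_fun /rowwise_coord !raddfD coordD.
have [F' [n' h]] := (BQp_cont e).2 [seq col_of i | i <- F] n.
exists [seq code a b | a <- [seq row_of i | i <- F], b <- F'], n' => xi [b1 b2].
split=> [|i iF].
  apply/integralP => j; rewrite coord_rowwise_fun.
  by apply: (integralP _ _); apply: e_integral; exact: take_row_integral.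
rewrite coord_rowwise_fun; suff /h [_ hF] : ball F' n' (take_row (row_of i) xi).
  by apply: hF; exact: map_f.
split=> [|j jF]; first exact: take_row_integral.
rewrite coord_take_row; apply: b2; apply/allpairsPdep.
by exists (row_of i), j; split=> //; exact: map_f.
Qed.

Definition rowwise : B := mkB rowwise_cont.

Lemma take_rowwise k xi : take_row k (rowwise xi) = e (take_row k xi).
Proof.
apply: coord_inj => j.
by rewrite coord_take_row [LHS]coord_rowwise_fun /rowwise_coord row_of_code col_of_code.
Qed.

Lemma take_rowwiseE k : take_row k * rowwise = e * take_row k.
Proof. by apply: BQp_eqP => xi; exact: take_rowwise. Qed.

Lemma rowwise_putE k : rowwise * put_row k = put_row k * e.
Proof.
apply: BQp_eqP => xi; apply: rows_inj => l; rewrite !BQpME take_rowwise !take_put_row.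
by case: eqP => _ //; exact: BQp_fun0.
Qed.

Lemma rowwise_pushE : rowwise * push_rows = push_rows * rowwise.
Proof.
apply: BQp_eqP => xi; apply: rows_inj => l; rewrite !BQpME take_rowwise !take_push_rows.
by case: l => [|l]; rewrite ?take_rowwise //; exact: BQp_fun0.
Qed.

Lemma rowwise_pullE : rowwise * pull_rows = pull_rows * rowwise.
Proof.
apply: BQp_eqP => xi; apply: rows_inj => l.
by rewrite !BQpME take_rowwise !take_pull_rows take_rowwise.
Qed.

Lemma rowwise_idem : e * e = e -> rowwise * rowwise = rowwise.
Proof.
move=> ee; apply: BQp_eqP => xi; apply: rows_inj => l.
by rewrite !BQpME !take_rowwise -(BQpME e e) ee.
Qed.

End RowWise.

Lemma take_putE k l : take_row k * put_row l = (k == l)%:R.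
Proof. by apply: BQp_eqP => xi; rewrite BQpME take_put_row; case: eqP. Qed.

Lemma pull_pushE : pull_rows * push_rows = 1.
Proof.
by apply: BQp_eqP => xi; apply: rows_inj => l; rewrite !BQpME take_pull_rows take_push_rows.
Qed.

Lemma pull_putE : pull_rows * put_row 0 = 0.
Proof.
apply: BQp_eqP => xi; apply: rows_inj => l.
by rewrite !BQpME take_pull_rows take_put_row BQp0E BQp_fun0.
Qed.

Lemma take_pushE : take_row 0 * push_rows = 0.
Proof. by apply: BQp_eqP => xi; rewrite BQpME take_push_rows. Qed.

Lemma push_pullE : push_rows * pull_rows + put_row 0 * take_row 0 = 1.
Proof.
apply: BQp_eqP => xi; apply: rows_inj => l.
rewrite BQpDE BQp_funD !BQpME take_push_rows take_put_row BQp1E.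
by case: l => [|l]; rewrite ?eqxx ?add0r // take_pull_rows addr0.
Qed.

End Rows.

(** * The unit absorbs every idempotent matrix *)

Section Swindle.
Variables (p : nat) (pp : prime p).
Local Notation B := (BQp pp).

(* Conjugating [A], embedded in [B], to an idempotent [e] preserving [Z_p^N],
   the rowwise action [T] of [e] satisfies [im e + im T = im T] by a shift of
   the rows, and [1 = T + (1 - T)]. *)
Lemma idempotent_absorbed n (A : 'M[B]_n) : A *m A = A ->
  exists (x : 'M[B]_(n + 1, 1)) (y : 'M[B]_(1, n + 1)),
    x *m y = block_mx A 0 0 1%:M /\ y *m x = 1%:M.
Proof.
move=> AA.
(* Rho and Iota exhibit V^n as the direct summand of V formed by the rows of index below n. This
   makes A equivalent to an idempotent f of B itself. *)
pose Rho : 'M[B]_(n, 1) := \matrix_(i, j) take_row pp i.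
pose Iota : 'M[B]_(1, n) := \matrix_(i, j) put_row pp j.
have RI : Rho *m Iota = 1%:M.
  apply/matrixP => i j; rewrite !mxE big_ord1 !mxE; exact: take_putE.
pose f : B := (Iota *m A *m Rho) 0 0.
have fM : f%:M = Iota *m A *m Rho by rewrite -mx11_scalar.
have ff : f * f = f.
  have : (f * f)%:M = f%:M :> 'M[B]_1.
    rewrite scalar_mxM fM !mulmxA -(mulmxA (Iota *m A) Rho) RI mulmx1.
    by rewrite -(mulmxA Iota) AA.
  by move=> /matrixP /(_ 0 0); rewrite !mxE.
have [g [h [gh hg hfg]]] := idempotent_conj_integral ff.
pose e : B := h * f * g.
have ee : e * e = e by rewrite /e !mulrA -(mulrA (h * f) g h) gh mulr1 -(mulrA h f f) ff.
have eL : {in @integral p pp, forall xi, e xi \in @integral p pp} by [].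
have gef : g * e = f * g by rewrite /e !mulrA gh mul1r.
have ehf : e * h = h * f by rewrite /e -mulrA gh mulr1.
clearbody e f.
pose T : B := rowwise eL.
pose r : B := take_row pp 0; pose i : B := put_row pp 0.
pose S : B := push_rows pp; pose S' : B := pull_rows pp.
have TT : T * T = T by exact: rowwise_idem.
have rT : r * T = e * r by exact: take_rowwiseE.
have Ti : T * i = i * e by exact: rowwise_putE.
have TS : T * S = S * T by exact: rowwise_pushE.
have TS' : T * S' = S' * T by exact: rowwise_pullE.
have ri : r * i = 1 by exact: take_putE.
have S'S : S' * S = 1 by exact: pull_pushE.
have S'i : S' * i = 0 by exact: pull_putE.
have rS : r * S = 0 by exact: take_pushE.
have SS' : S * S' + i * r = 1 by exact: push_pullE.
clearbody T r i S S'.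
have [Q [TQ QT QQ TDQ]] : exists Q, [/\ T * Q = 0, Q * T = 0, Q * Q = Q & T + Q = 1].
  have QT : (1 - T) * T = 0 by rewrite mulrBl mul1r TT subrr.
  exists (1 - T); split=> //; last by rewrite addrC subrK.
    by rewrite mulrBr mulr1 TT subrr.
  by rewrite mulrBr mulr1 QT subr0.
(* v moves im T one row up and fixes im Q; u moves it back. What v misses is row 0 of im T, the
   image of i r T = i e r, an idempotent equivalent to e. *)
pose u := S' * T + Q; pose v := Q + S * T.
have uv : u * v = 1.
  rewrite /u /v mulrDl !mulrDr QQ -!(mulrA S') TQ mulr0 add0r -TS (mulrA Q T) QT.
  by rewrite mul0r addr0 (mulrA T T) TT TS (mulrA S') S'S mul1r.
have vu : v * u + i * r * T = 1.
  rewrite /u /v mulrDl !mulrDr QQ -TS' (mulrA Q T) QT mul0r add0r -!(mulrA S) TQ.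
  rewrite mulr0 addr0 (mulrA T T) TT TS' (mulrA S) -addrA -mulrDl SS' mul1r.
  by rewrite addrC.
have ier : i * e * (e * r) = i * r * T.
  by rewrite mulrA -(mulrA i e) ee -!mulrA rT.
(* x1 and y1 realise the equivalence between A and that row 0, through the conjugation by g and
   h. *)
pose x1 : 'M[B]_(n, 1) := Rho *m (g * e * r)%:M.
pose y1 : 'M[B]_(1, n) := (i * e * h)%:M *m Iota.
have x1y1 : x1 *m y1 = A.
  rewrite /x1 /y1 !mulmxA -(mulmxA Rho) -scalar_mxM.
  have -> : g * e * r * (i * e * h) = f.
    rewrite -!mulrA (mulrA r) ri mul1r (mulrA e e) ee mulrA gef -mulrA.
    by rewrite gh mulr1.
  by rewrite fM !mulmxA RI mul1mx -mulmxA RI mulmx1.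
have y1x1 : y1 *m x1 = (i * r * T)%:M.
  (* Iota Rho is only the projection onto the first n rows; it disappears because f absorbs it. *)
  have fIR : f%:M *m (Iota *m Rho) = f%:M.
    by rewrite fM !mulmxA -(mulmxA _ Rho Iota) RI mulmx1.
  have ehf' : i * e * h = i * e * h * f.
    by rewrite -!mulrA -ehf (mulrA e) ee.
  rewrite /x1 /y1 mulmxA -(mulmxA _ Iota) ehf' [(_ * f)%:M]scalar_mxM -(mulmxA _ f%:M) fIR.
  rewrite -!scalar_mxM -ehf' !mulrA -(mulrA _ h g) hg mulr1.
  by rewrite -mulrA ier.
(* A fills the row left free by v, so y x = i r T + v u = 1. The off-diagonal blocks of x y vanish
   because r S = 0, S' i = 0 and T Q = Q T = 0. *)
exists (col_mx x1 u%:M), (row_mx y1 v%:M); split.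
  rewrite mul_col_row x1y1; congr block_mx.
  - have erQ : e * r * Q = 0 by rewrite -rT -mulrA TQ mulr0.
    rewrite /x1 -mulmxA -scalar_mxM /v -(mulrA g) -mulrA mulrDr erQ add0r.
    by rewrite -(mulrA e) (mulrA r) rS mul0r !mulr0 raddf0 mulmx0.
  - have uTi : u * (T * i) = 0.
      rewrite /u mulrDl mulrA -(mulrA S') TT (mulrA Q) QT mul0r addr0.
      by rewrite -mulrA Ti mulrA S'i mul0r.
    by rewrite /y1 mulmxA -scalar_mxM -Ti mulrA uTi mul0r raddf0 mul0mx.
  - by rewrite -scalar_mxM uv.
by rewrite mul_row_col y1x1 -scalar_mxM -raddfD addrC vu.
Qed.

End Swindle.

(** * Matrices and K_0 *)

Section Matrices.
Variables (p : nat) (pp : prime p).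
Local Notation B := (BQp pp).
Local Notation T := (QN p -> QN p).
Local Notation add := (@B_add p).
Local Notation mul := (@B_mul p).
Local Notation zero := (@B_zero p).

(** Passage from library matrices over the ring B, where block algebra is available, to the matrices
    of bare maps in which K_0 is stated. *)
Definition ofmx m n (A : 'M[B]_(m, n)) : mx T m n := fun i j => sval (A i j).

Lemma sval_add (f g : B) : sval (f + g) = add (sval f) (sval g).
Proof.
by apply: funext => xi; rewrite /B_add -(QpN_addE (f xi : QpN pp) (g xi)).
Qed.

Lemma sval_zero : sval (0 : B) = zero.
Proof. by apply: funext => xi; rewrite /B_zero (QN_zeroE (xi : QpN pp)). Qed.

Lemma ofmx_inj m n (A A' : 'M[B]_(m, n)) : ofmx A = ofmx A' -> A = A'.
Proof.
move=> e; apply/matrixP => i j; apply: BQp_eqP => xi.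
exact: (congr1 (fun x : mx T m n => x i j xi) e).
Qed.

Lemma ofmx_over m n (A : 'M[B]_(m, n)) : mx_over (@inB p) (ofmx A).
Proof. by move=> i j; exact: inB_sval. Qed.

Lemma mx_over_ofmx m n (x : mx T m n) : mx_over (@inB p) x ->
  exists A : 'M[B]_(m, n), x = ofmx A.
Proof.
move=> xB; exists (\matrix_(i, j) (exist _ (x i j) (asboolT (xB i j)) : B)).
by apply: funext => i; apply: funext => j; rewrite /ofmx mxE.
Qed.

Lemma ofmxM m k n (A : 'M[B]_(m, k)) (A' : 'M[B]_(k, n)) :
  mulM add mul zero (ofmx A) (ofmx A') = ofmx (A *m A').
Proof.
apply: funext => i; apply: funext => j; rewrite /mulM /ofmx mxE.
by rewrite (big_morph (fun f : B => sval f) sval_add sval_zero).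
Qed.

Lemma ofmx_diag m n (A : 'M[B]_m) (A' : 'M[B]_n) :
  diagM zero (ofmx A) (ofmx A') = ofmx (block_mx A 0 0 A').
Proof.
apply: funext => i; apply: funext => j; rewrite /diagM /ofmx.
case: (split_ordP i) => i' ->; case: (split_ordP j) => j' ->; rewrite ?split_lshift ?split_rshift.
- by rewrite block_mxEul.
- by rewrite block_mxEur mxE sval_zero.
- by rewrite block_mxEdl mxE sval_zero.
- by rewrite block_mxEdr.
Qed.

Lemma idem_ofmx n (x : mx T n n) : idem (@inB p) add mul zero x ->
  exists A : 'M[B]_n, x = ofmx A /\ A *m A = A.
Proof.
move=> [/mx_over_ofmx [A ->] AA]; exists A; split=> //.
by apply: ofmx_inj; rewrite -ofmxM.
Qed.

(** Both sides are equivalent to the 1 by 1 identity, and the two equivalences are composed through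
    it. *)
Lemma mvn_absorbed m n (A : 'M[B]_m) (A' : 'M[B]_n) : A *m A = A -> A' *m A' = A' ->
  mvn_eq (@inB p) add mul zero (ofmx (block_mx A 0 0 (1%:M : 'M_1)))
    (ofmx (block_mx A' 0 0 (1%:M : 'M_1))).
Proof.
move=> /idempotent_absorbed [x [y [xy yx]]] /idempotent_absorbed [z [w [zw wz]]].
exists (ofmx (x *m w)), (ofmx (z *m y)); split; first exact: ofmx_over.
split; first exact: ofmx_over.
split; rewrite ofmxM; congr ofmx.
  by rewrite mulmxA -(mulmxA x) wz mulmx1.
by rewrite mulmxA -(mulmxA z) yx mulmx1.
Qed.

Lemma block_idem m n (A : 'M[B]_m) (A' : 'M[B]_n) : A *m A = A -> A' *m A' = A' ->
  block_mx A 0 0 A' *m block_mx A 0 0 A' = block_mx A 0 0 A'.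
Proof. by move=> AA AA'; rewrite mulmx_block !mul0mx !mulmx0 !addr0 add0r AA AA'. Qed.

End Matrices.

Theorem theorem3p16 (p : nat) : prime p -> K0_B_trivial p.
Proof.
move=> pp [n m e f eidem fidem].
have [A [eA AA]] := idem_ofmx pp eidem; have [A' [fA' AA']] := idem_ofmx pp fidem.
have zz := @mx00_idem (QN p -> QN p) (@inB p) (@B_add p) (@B_mul p) (@B_zero p).
have [Z [zZ ZZ]] := idem_ofmx pp zz.
(* Taking the unit as stabilising summand gives both sides the form idempotent plus 1. *)
exists 1%N, (ofmx (1%:M : 'M[BQp pp]_1)); split.
  by split; [exact: ofmx_over|rewrite ofmxM mulmx1].
rewrite /= eA fA' zZ !ofmx_diag; apply: mvn_absorbed; exact: block_idem.
Qed.
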